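(* Assume the setting below with $\mathcal{L}\in H^{-2}(\Omega)^k$. Let $\mathcal{D}=(X_{\mathcal{D},0},\Pi_{\mathcal{D}},\nabla_{\mathcal{D}},\mathcal{H}_{\mathcal{D}})$ be a Hessian discretisation and $E_{\mathcal{D}}$ a companion operator for it with $\Gamma(E_{\mathcal{D}})<\infty$. Then there exists at least one solution $\Psi_{\mathcal{D}}\in X_{\mathcal{D},0}^k$ of the Hessian scheme $$\mathcal{A}(\mathcal{H}_{\mathcal{D}}\Psi_{\mathcal{D}},\mathcal{H}_{\mathcal{D}}\Phi_{\mathcal{D}})+\mathcal{B}(\mathcal{H}_{\mathcal{D}}\Psi_{\mathcal{D}},\nabla_{\mathcal{D}}\Psi_{\mathcal{D}},\nabla_{\mathcal{D}}\Phi_{\mathcal{D}})=\mathcal{L}(E_{\mathcal{D}}\Phi_{\mathcal{D}})\quad\text{for all }\Phi_{\mathcal{D}}\in X_{\mathcal{D},0}^k.$$ Furthermore, if $$\|\mathcal{L}\|_{-2}<\frac{\overline{\alpha}^2}{\|\mathcal{B}\|\,C_{\mathcal{D}}^2\,\Gamma(E_{\mathcal{D}})\,C_{2,\rm eq}},$$ then this solution is unique.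
   Context: Let $\Omega\subset\mathbb{R}^d$ ($d\ge1$) be a bounded domain, $k\ge1$ an integer, $X=H^2_0(\Omega)$. For a function space $E$, norms on $E^k$ are written as on $E$; $\|\cdot\|$ is the $L^2$ norm, $\|\cdot\|_{0,4}$ the $L^4$ norm, $\|\cdot\|_m$ and $|\cdot|_m$ the $H^m$ norm and seminorm. $\|\cdot\|_{-2}$ is the dual norm on $H^{-2}(\Omega)^k=(H^2_0(\Omega)^k)'$ with respect to $\|\cdot\|_2$. $\mathcal{H}$ denotes the Hessian; for $\Psi=(\psi_1,\dots,\psi_k)$, $\mathcal{H}\Psi$, $\nabla\Psi$ act componentwise. $C_{2,\rm eq}$ is a constant with $\|\varphi\|_2\le C_{2,\rm eq}|\varphi|_2$ for all $\varphi\in H^2_0(\Omega)$ (here $|\varphi|_2=\|\mathcal{H}\varphi\|$). Standing assumptions: $\mathcal{A}$ is a continuous bilinear form on $L^2(\Omega;\mathbb{R}^{d\times d})^k$, coercive with constant $\overline{\alpha}>0$ ($\mathcal{A}(\Xi,\Xi)\ge\overline{\alpha}\|\Xi\|^2$); $\mathcal{B}$ is a continuous trilinear form on $L^2(\Omega;\mathbb{R}^{d\times d})^k\times L^4(\Omega;\mathbb{R}^d)^k\times L^4(\Omega;\mathbb{R}^d)^k$ with norm $\|\mathcal{B}\|$, and $\mathcal{B}(\Xi,\Theta,\Theta)=0$ for all $\Xi\in L^2(\Omega;\mathbb{R}^{d\times d})^k$, $\Theta\in L^4(\Omega;\mathbb{R}^d)^k$; $\mathcal{L}$ is a continuous linear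 functional on $H^2_0(\Omega)^k$. A Hessian discretisation is a quadruple $\mathcal{D}=(X_{\mathcal{D},0},\Pi_{\mathcal{D}},\nabla_{\mathcal{D}},\mathcal{H}_{\mathcal{D}})$ where $X_{\mathcal{D},0}$ is a finite-dimensional real vector space and $\Pi_{\mathcal{D}}:X_{\mathcal{D},0}\to L^2(\Omega)$, $\nabla_{\mathcal{D}}:X_{\mathcal{D},0}\to L^4(\Omega;\mathbb{R}^d)$, $\mathcal{H}_{\mathcal{D}}:X_{\mathcal{D},0}\to L^2(\Omega;\mathbb{R}^{d\times d})$ are linear maps such that $\|w\|_{\mathcal{D}}:=\|\mathcal{H}_{\mathcal{D}}w\|$ is a norm on $X_{\mathcal{D},0}$. A companion operator is a linear map $E_{\mathcal{D}}:X_{\mathcal{D},0}\to H^2_0(\Omega)$, and $\Gamma(E_{\mathcal{D}}):=\sup_{\psi\in X_{\mathcal{D},0}\setminus\{0\}}\|\mathcal{H}E_{\mathcal{D}}\psi\|/\|\psi\|_{\mathcal{D}}$. All these maps act componentwise on $X_{\mathcal{D},0}^k$ (and $\|\cdot\|_{\mathcal{D}}$ is extended accordingly). Finally $C_{\mathcal{D}}:=\max_{w\in X_{\mathcal{D},0}\setminus\{0\}}\max\{\|\Pi_{\mathcal{D}}w\|/\|w\|_{\mathcal{D}},\ \|\nabla_{\mathcal{D}}w\|_{0,4}/\|w\|_{\mathcal{D}}\}$. *)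

(* Defs.v *)
From HB Require Import structures.
From mathcomp Require Import all_boot all_order all_algebra.
From mathcomp Require Import classical_sets reals normedtype.
Set Implicit Arguments. Unset Strict Implicit. Unset Printing Implicit Defensive.
Import Order.TTheory GRing.Theory Num.Theory.
Import numFieldNormedType.Exports.
Local Open Scope classical_set_scope.
Local Open Scope ring_scope.

(* Abstract model of the function spaces:
   the scalar spaces L^2(Omega), L^4(Omega;R^d), L^2(Omega;R^{dxd}),
   H^2_0(Omega) are normed R-vector spaces; a k-tuple space E^k is
   {ffun 'I_k -> E} with the Euclidean (l^2) product norm. *)

Section Defs.
Variable R : realType.

Definition tnorm (k : nat) (V : normedModType R) (f : {ffun 'I_k -> V}) : R :=
  Num.sqrt (\sum_(i < k) `|f i| ^+ 2).

Definition tmap (k : nat) (U V : Type) (F : U -> V) (f : {ffun 'I_k -> U})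
  : {ffun 'I_k -> V} := [ffun i => F (f i)].

Definition bilinear_form (T : lmodType R) (A : T -> T -> R) : Prop :=
  (forall a x y z, A (a *: x + y) z = a * A x z + A y z) /\
  (forall a x y z, A z (a *: x + y) = a * A z x + A z y).

Definition trilinear_form (T1 T2 T3 : lmodType R) (B : T1 -> T2 -> T3 -> R) : Prop :=
  (forall a x y u v, B (a *: x + y) u v = a * B x u v + B y u v) /\
  (forall a x y u v, B u (a *: x + y) v = a * B u x v + B u y v) /\
  (forall a x y u v, B u v (a *: x + y) = a * B u v x + B u v y).

Definition linear_functional (T : lmodType R) (L : T -> R) : Prop :=
  forall a x y, L (a *: x + y) = a * L x + L y.

Definition trinorm (T1 T2 T3 : lmodType R) (N1 : T1 -> R) (N2 : T2 -> R)
  (N3 : T3 -> R) (B : T1 -> T2 -> T3 -> R) : R :=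
  sup [set r | exists x y z, x != 0 /\ y != 0 /\ z != 0 /\
                 r = `|B x y z| / (N1 x * N2 y * N3 z)].

Definition dualnorm (T : lmodType R) (N : T -> R) (L : T -> R) : R :=
  sup [set r | exists x, x != 0 /\ r = `|L x| / N x].

Definition Gamma_set (XD : lmodType R) (M H : normedModType R)
  (HD : XD -> M) (Hess : H -> M) (ED : XD -> H) : set R :=
  [set r | exists psi, psi != 0 /\ r = `|Hess (ED psi)| / `|HD psi|].

Definition Gamma (XD : lmodType R) (M H : normedModType R)
  (HD : XD -> M) (Hess : H -> M) (ED : XD -> H) : R :=
  sup (Gamma_set HD Hess ED).

Definition C_D (XD : lmodType R) (L2 L4 M : normedModType R)
  (PiD : XD -> L2) (GD : XD -> L4) (HD : XD -> M) : R :=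
  sup [set r | exists w, w != 0 /\
         r = Num.max (`|PiD w| / `|HD w|) (`|GD w| / `|HD w|)].

End Defs.

(* Main.v *)
(** Existence: in coordinates the scheme is a continuous map F on R^n, and since
    B(Xi, Theta, Theta) = 0 and A is coercive, F(x).x > 0 on the boundary of a
    large cube. Such a map has a zero by a Brouwer-type argument. Label the
    lattice points of the cube by the signs of the components of F, forced on the
    faces; the mod 2 cup product of the coboundaries of the labels sums to 1 over
    the grid by Stokes' theorem, so some small cube sees both labels in every
    component. A limit point x of such cubes satisfies F_j(x) x_j <= 0 for all j,
    with F_j(x) = 0 unless x_j lies on the boundary, so F(x) = 0.

    Uniqueness: testing with Psi gives |Psi|_D <= |L| Gamma C_{2,eq} / alpha, and the
    difference e of two solutions satisfies A(He, He) = - B(He, G Psi, Ge), hence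
    alpha |e|^2 <= |B| C_D^2 |Psi|_D |e|^2. *)

Require Import Defs.
From HB Require Import structures.
From mathcomp Require Import all_boot all_order all_algebra.
From mathcomp Require Import zify ring lra.
Set Implicit Arguments. Unset Strict Implicit. Unset Printing Implicit Defensive.
Import Order.TTheory GRing.Theory Num.Theory.
Local Open Scope ring_scope.

(** * A mod 2 labelling lemma *)

Lemma addF2_self (x : 'F_2) : x + x = 0.
Proof. by apply: addrr_pchar2; apply: pchar_Fp. Qed.

(** The swap of [i] and [j] pairs off equal terms, which cancel in characteristic 2. *)
Lemma sum_symmetric_F2 (I : finType) (J : {set I}) (h : I -> I -> 'F_2) :
    (forall i j, h i j = h j i) ->
  \sum_(i in J) \sum_(j in J :\ i) h i j = 0.
Proof.
move=> hC; rewrite (pair_big_dep (mem J) (fun i j => j \in J :\ i)) /=.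
rewrite (bigID (fun u => enum_rank u.1 < enum_rank u.2)%N) /=.
rewrite [X in _ + X](reindex_inj (h := fun u => (u.2, u.1))) /=; last first.
  by move=> [a b] [c d] [-> ->].
rewrite [X in _ + X](eq_big (fun u : I * I =>
  [&& u.1 \in J, u.2 \in J :\ u.1 & enum_rank u.1 < enum_rank u.2]%N)
  (fun u => h u.1 u.2)).
- rewrite [X in X + _](eq_bigl (fun u : I * I =>
    [&& u.1 \in J, u.2 \in J :\ u.1 & enum_rank u.1 < enum_rank u.2]%N)).
    exact: addF2_self.
  by move=> [a b] /=; rewrite andbA.
- move=> [a b] /=; rewrite !inE -leqNgt (eq_sym b a).
  case: (altP (a =P b)) => /= [->|ab]; first by rewrite !andbF.
  rewrite leq_eqVlt; suff -> : (enum_rank a == enum_rank b :> nat) = false.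
    by rewrite /= andbCA !andbA.
  by apply/negbTE; apply: contra ab => /eqP/ord_inj/enum_rank_inj ->.
- by move=> [a b] _ /=; rewrite hC.
Qed.

(** * Cubical cochains mod 2: cup product and coboundary *)

Section CubicalCochains.
Variable n : nat.
Let point := {ffun 'I_n -> nat}.
Implicit Types (q x : point) (J : {set 'I_n}) (j : 'I_n) (l : point -> 'F_2).
Implicit Types (Ls : seq (point -> 'F_2)) (c : {set 'I_n} -> point -> 'F_2).

Definition upd x j (v : nat) : point := [ffun i => if i == j then v else x i].
Definition step x j : point := upd x j (x j).+1.

Lemma upd_same x j v : upd x j v j = v.
Proof. by rewrite ffunE eqxx. Qed.

Lemma upd_neq x i j v : i != j -> upd x j v i = x i.
Proof. by move=> /negbTE ij; rewrite ffunE ij. Qed.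

Lemma updC x i j v w : i != j -> upd (upd x i v) j w = upd (upd x j w) i v.
Proof.
move=> ij; apply/ffunP=> h; rewrite !ffunE.
by case: (altP (h =P j)) => [->|//]; rewrite eq_sym (negbTE ij).
Qed.

Lemma updK x j v w : upd (upd x j v) j w = upd x j w.
Proof. by apply/ffunP=> h; rewrite !ffunE; case: eqP. Qed.

Lemma stepE x j i : step x j i = (x i + (i == j))%N.
Proof. by rewrite ffunE; case: eqP => [->|]; rewrite (addn1, addn0). Qed.

Lemma stepC x i j : step (step x i) j = step (step x j) i.
Proof. by apply/ffunP=> h; rewrite !stepE addnAC. Qed.

(* The cubical cup product dl_1 u ... u dl_m, evaluated on the cube with least
   corner [q] spanned by the directions in [J]: a sum over the monotone edge
   paths of the cube, the i-th edge contributing the increment of l_i. *)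
Fixpoint cup Ls J q : 'F_2 :=
  if Ls is l :: Ls' then
    \sum_(j in J) (l (step q j) + l q) * cup Ls' (J :\ j) (step q j)
  else (J == set0)%:R.

Lemma cup_cons l Ls J q : cup (l :: Ls) J q =
  \sum_(j in J) (l (step q j) + l q) * cup Ls (J :\ j) (step q j).
Proof. by []. Qed.

(** A cochain value [c J q] belongs to the cube with least corner [q] and directions [J]; the sum
    runs over the two faces orthogonal to each direction, without signs since -1 = 1 in ['F_2]. *)
Definition coboundary c J q : 'F_2 :=
  \sum_(j in J) (c (J :\ j) (step q j) + c (J :\ j) q).

Lemma eq_coboundary c c' : (forall J q, c J q = c' J q) ->
  forall J q, coboundary c J q = coboundary c' J q.
Proof. by move=> cc J q; apply: eq_bigr => j _; rewrite !cc. Qed.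

Lemma coboundary_coboundary c J q : coboundary (coboundary c) J q = 0.
Proof.
rewrite /coboundary -[RHS](@sum_symmetric_F2 _ J (fun i j =>
  let K := J :\ i :\ j in
  c K (step (step q i) j) + c K (step q i) + (c K (step q j) + c K q))).
  by apply: eq_bigr => i _ /=; rewrite -big_split.
move=> i j /=.
have -> : J :\ j :\ i = J :\ i :\ j.
  by apply/setP => h; rewrite !inE; case: eqP; case: eqP.
by rewrite (stepC q j i); ring.
Qed.

(** Leibniz rule d(l w) = dl u w + l dw, whose last term vanishes for a closed w. *)
Lemma cup_cons_coboundary l Ls :
    (forall J q, coboundary (cup Ls) J q = 0) ->
  forall J q, cup (l :: Ls) J q =
    coboundary (fun J q => l q * cup Ls J q) J q.
Proof.
move=> dLs J q.
transitivity (cup (l :: Ls) J q + l q * coboundary (cup Ls) J q).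
  by rewrite dLs mulr0 addr0.
rewrite cup_cons /coboundary mulr_sumr -big_split; apply: eq_bigr => j _ /=.
have := addF2_self (l q * cup Ls (J :\ j) (step q j)).
set a := l (step q j); set b := l q; set w := cup _ _ _; set w' := cup _ _ q.
move=> h; transitivity (a * w + b * w' + (b * w + b * w)); first by ring.
by rewrite h addr0.
Qed.

(** By induction: a nonempty product is a coboundary by the Leibniz rule, hence closed. *)
Lemma coboundary_cup Ls J q : coboundary (cup Ls) J q = 0.
Proof.
elim: Ls J q => [|l Ls IH] J q; last first.
  rewrite (eq_coboundary (cup_cons_coboundary l IH)).
  exact: coboundary_coboundary.
by apply: big1 => j _; exact: addF2_self.
Qed.

(** No path of the cube moves in direction [i], so it stays where [l] is constant and the increment
    of [l] vanishes. *)
Lemma cup_const l Ls (i : 'I_n) (v : nat) J q (e : 'F_2) :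
  List.In l Ls -> (forall x, x i = v -> l x = e) ->
  i \notin J -> q i = v -> cup Ls J q = 0.
Proof.
move=> lLs hl; elim: Ls lLs J q => //= l' Ls IH h J q iJ qi.
apply: big1 => j jJ; have ij : i != j by apply: contraNneq iJ => ->.
have qi' : step q j i = v by rewrite upd_neq.
case: h => [->|h]; first by rewrite !hl // addF2_self mul0r.
by rewrite (IH h) ?mulr0 // !inE (negbTE iJ) andbF.
Qed.

(** * Summation over a grid and the mod 2 Stokes theorem *)

Section Grid.
Variable p : nat.
Implicit Types (f g : point -> 'F_2) (js : seq 'I_n).

Fixpoint grid_sum js f x : 'F_2 :=
  if js is j :: js' then \sum_(v < p) grid_sum js' f (upd x j v) else f x.

Lemma eq_grid_sum js f g x : (forall y, f y = g y) ->
  grid_sum js f x = grid_sum js g x.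
Proof.
move=> fg; elim: js x => //= j js IH x; by apply: eq_bigr => v _; rewrite IH.
Qed.

Lemma grid_sum0 js x : grid_sum js (fun=> 0) x = 0.
Proof. by elim: js x => //= j js IH x; apply: big1 => v _. Qed.

Lemma grid_sumD js f g x :
  grid_sum js (fun y => f y + g y) x = grid_sum js f x + grid_sum js g x.
Proof.
elim: js x => //= j js IH x; rewrite -big_split.
by apply: eq_bigr => v _; rewrite IH.
Qed.

Lemma grid_sum_sum (I : finType) (P : pred I) js (f : I -> point -> 'F_2) x :
  grid_sum js (fun y => \sum_(i | P i) f i y) x =
  \sum_(i | P i) grid_sum js (f i) x.
Proof.
elim: js x => //= j js IH x; rewrite exchange_big.
by apply: eq_bigr => v _; rewrite IH.
Qed.

Lemma grid_sum_upd js f x j v : j \notin js ->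
  grid_sum js (fun y => f (upd y j v)) x = grid_sum js f (upd x j v).
Proof.
elim: js x => //= i js IH x; rewrite inE negb_or => /andP[ji jjs].
by apply: eq_bigr => w _; rewrite IH // updC // eq_sym.
Qed.

Lemma telescope_F2 (a : nat -> 'F_2) m :
  \sum_(v < m) (a v.+1 + a v) = a m + a 0%N.
Proof.
elim: m => [|m IH]; first by rewrite big_ord0 addF2_self.
rewrite big_ord_recr /= IH; have := addF2_self (a m) => h.
by transitivity (a m.+1 + a 0%N + (a m + a m)); [ring | rewrite h addr0].
Qed.

(** Along direction [j] the increments telescope, which leaves the two faces at [p] and 0. *)
Lemma grid_sum_telescope js f x j : uniq js -> j \in js ->
  grid_sum js (fun y => f (step y j) + f y) x =
  grid_sum (rem j js) (fun y => f (upd y j p) + f (upd y j 0)) x.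
Proof.
elim: js x => //= i js IH x /andP[ijs ujs]; rewrite inE eq_sym.
case: (altP (i =P j)) => /= [<- _|ij jjs]; last first.
  by apply: eq_bigr => v _; rewrite IH.
rewrite (eq_bigr (fun v : 'I_p => grid_sum js (fun y => f (upd y i v.+1)) x
  + grid_sum js (fun y => f (upd y i v)) x)).
  rewrite grid_sumD.
  exact: (telescope_F2 (fun v => grid_sum js (fun y => f (upd y i v)) x)).
move=> v _; rewrite -grid_sumD -[LHS]grid_sum_upd //; apply: eq_grid_sum => y.
by rewrite /step updK upd_same.
Qed.

Lemma grid_sum_neq0 js f x : uniq js -> grid_sum js f x != 0 ->
  exists2 q, f q != 0 &
    (forall j, j \in js -> (q j < p)%N) /\ (forall j, j \notin js -> q j = x j).
Proof.
elim: js x => [|i js IH] x /=; first by move=> _ h; exists x.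
move=> /andP[ijs ujs] h.
have /existsP[v hv] : [exists v : 'I_p, grid_sum js f (upd x i v) != 0].
  apply: contraNT h; rewrite negb_exists => /forallP h.
  by rewrite big1 // => v _; apply/eqP; rewrite -[_ == _]negbK h.
have [q fq [q1 q2]] := IH _ ujs hv; exists q => //; split=> j.
  rewrite inE => /orP[/eqP ->|]; last exact: q1.
  by rewrite q2 // upd_same.
by rewrite inE negb_or => /andP[ji jjs]; rewrite q2 // upd_neq.
Qed.

(* Stokes: [cup] is a coboundary, so its sum over the grid only sees the faces
   of the grid. A face orthogonal to a direction other than the first one
   contributes 0 because one of the labels is constant on it; the two faces
   orthogonal to the first direction give the sum of one dimension less. *)
Lemma grid_sum_cup (lam : 'I_n -> point -> 'F_2) js x :
    (forall j x, x j = 0%N -> lam j x = 0) ->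
    (forall j x, x j = p -> lam j x = 1) -> uniq js ->
  grid_sum js (cup (map lam js) [set j in js]) x = 1.
Proof.
move=> lam0 lamp; elim: js x => [|j js IH] x.
  move=> _ /=; suff -> : [set j in [::]] = set0 :> {set 'I_n} by rewrite eqxx.
  by apply/setP => i; rewrite !inE.
move=> /[dup] ujjs; rewrite cons_uniq => /andP[jjs ujs].
pose J := [set i in j :: js].
pose c := fun J q => lam j q * cup (map lam js) J q.
have Jj : J :\ j = [set i in js].
  apply/setP=> i; rewrite !inE; case: eqP => //= ->.
  by rewrite (negbTE jjs).
transitivity (grid_sum (j :: js) (fun q => \sum_(i in J)
    (c (J :\ i) (step q i) + c (J :\ i) q)) x).
  apply: eq_grid_sum => q.
  exact: (cup_cons_coboundary (lam j) (coboundary_cup (map lam js))).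
have jJ : j \in J by rewrite !inE eqxx.
rewrite grid_sum_sum (bigD1 j jJ) big1 => [|i].
  rewrite [LHS]addr0.
  have -> := @grid_sum_telescope (j :: js) (c (J :\ j)) x j ujjs (mem_head _ _).
  rewrite /= eqxx Jj -[RHS](IH (upd x j p) ujs) -grid_sum_upd //.
  apply: eq_grid_sum => y.
  by rewrite /c lamp ?lam0 ?upd_same // mul1r mul0r addr0.
move=> /andP[iJ ij]; have : i \in J := iJ; rewrite !inE (negbTE ij) orFb => ijs.
have -> := @grid_sum_telescope (j :: js) (c (J :\ i)) x i ujjs _; last first.
  by rewrite inE ijs orbT.
rewrite -[RHS](grid_sum0 (rem i (j :: js)) x); apply: eq_grid_sum => y.
have lam_in : List.In (lam i) (map lam js).
  elim: (js) ijs => //= h s IHs; rewrite inE => /orP[/eqP ->|/IHs]; by auto.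
rewrite /c (cup_const (e := 1) (v := p) lam_in (lamp i)) ?upd_same //;
  last by rewrite !inE eqxx.
rewrite (cup_const (e := 0) (v := 0%N) lam_in (lam0 i)) ?upd_same //.
  by rewrite !mulr0 addr0.
by rewrite !inE eqxx.
Qed.

End Grid.

(** A nonzero product has a path with all factors nonzero, so each label changes along its own
    edge. *)
Lemma cup_neq0 Ls J q : cup Ls J q != 0 ->
  forall l, List.In l Ls -> exists r s, l r != l s /\
    forall i, (q i <= r i <= (q i).+1)%N && (q i <= s i <= (q i).+1)%N.
Proof.
(* Strengthened for the induction: vertices move only in the directions of [J], so a step along [j]
   followed by a path in [J :\ j] stays in the cube. *)
suff H : cup Ls J q != 0 -> forall l, List.In l Ls ->
   exists r s, l r != l s /\ forall i,
   (q i <= r i <= q i + (i \in J))%N && (q i <= s i <= q i + (i \in J))%N.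
  move=> h l hl; have [r [s [rs hq]]] := H h l hl.
  exists r, s; split=> // i; have := hq i; case: (i \in J); lia.
elim: Ls J q => //= l Ls IH J q h l'.
have /existsP[j /andP[jJ hj]] : [exists j, (j \in J) &&
    ((l (step q j) + l q) * cup Ls (J :\ j) (step q j) != 0)].
  apply: contraNT h; rewrite negb_exists => /forallP h.
  rewrite big1 // => j jJ; have := h j; rewrite jJ /= negbK; by move/eqP.
move: hj; rewrite mulf_eq0 negb_or => /andP[hl hcup] [<-|l'Ls].
  exists (step q j), q; split.
    by apply: contraNneq hl => ->; rewrite addF2_self.
  by move=> i; rewrite stepE; case: eqP => [->|]; rewrite ?jJ; lia.
have [r [s [rs hq]]] := IH _ _ hcup _ l'Ls.
exists r, s; split=> // i; have := hq i; rewrite stepE !inE.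
by case: eqP => [->|] /=; rewrite ?jJ; lia.
Qed.

Lemma kuhn (p : nat) (lam : 'I_n -> point -> bool) :
    (0 < p)%N ->
    (forall j x, x j = 0%N -> lam j x = false) ->
    (forall j x, x j = p -> lam j x = true) ->
  exists q : point, (forall j, (q j < p)%N) /\
    forall j, exists r s, [/\ lam j r = false, lam j s = true &
     forall i, (q i <= r i <= (q i).+1)%N && (q i <= s i <= (q i).+1)%N].
Proof.
move=> p0 lam0 lamp.
pose mu j x : 'F_2 := (lam j x)%:R.
have mu0 j x : x j = 0%N -> mu j x = 0 by rewrite /mu => /lam0 ->.
have mup j x : x j = p -> mu j x = 1 by rewrite /mu => /lamp ->.
have := grid_sum_cup [ffun=> 0%N] mu0 mup (enum_uniq 'I_n).
move=> /eqP; rewrite -subr_eq0 => /eqP h.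
have /(grid_sum_neq0 (enum_uniq 'I_n))[q cq [qp _]] :
  grid_sum p (enum 'I_n) (cup (map mu (enum 'I_n)) [set j in enum 'I_n])
    [ffun=> 0%N] != 0.
  by move/eqP: h; rewrite subr_eq0 => /eqP ->; apply: oner_neq0.
exists q; split=> [j|j]; first by rewrite qp // mem_enum.
have muj : List.In (mu j) (map mu (enum 'I_n)).
  have : j \in enum 'I_n by rewrite mem_enum.
  elim: (enum _) => //= i s IHs; rewrite inE => /orP[/eqP ->|/IHs]; by auto.
have [r [s [rs hq]]] := cup_neq0 cq muj.
case lr: (lam j r); case ls: (lam j s);
  move: rs; rewrite /mu lr ls ?eqxx //= => _.
  by exists s, r; split=> // i; rewrite andbC.
by exists r, s.
Qed.

End CubicalCochains.

(** * Zeros of outward-pointing maps on a cube *)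

(* Loaded only here: [set0] and the set notations of classical_sets would shadow
   those of finset above. *)
From mathcomp Require Import boolp classical_sets reals topology normedtype.
From mathcomp Require Import derive.
Import numFieldNormedType.Exports.
Local Open Scope classical_set_scope.
Local Open Scope ring_scope.

Section VariationalInequality.
Variables (R : realType) (n : nat) (F : 'I_n -> 'rV[R]_n -> R) (rho : R).
Hypothesis rho_gt0 : 0 < rho.

Let node (p : nat) (x : {ffun 'I_n -> nat}) : 'rV[R]_n :=
  \row_i (- rho + 2 * rho * (x i)%:R / p.+1%:R).

(* Forcing the labels on the two faces orthogonal to direction [j] makes any
   [F] admissible in [kuhn]; the price is that a limit point may lie on a face
   without being a zero, as in [variational_inequality]. *)
Let lab (p : nat) (j : 'I_n) (x : {ffun 'I_n -> nat}) : bool :=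
  (x j != 0%N) && ((x j == p.+1) || (0 < F j (node p x))).

(** The point is a cluster point of the corners [u p] of the cubes that [kuhn] gives for each mesh
    size. *)
Lemma sign_change_point : exists2 x : 'rV[R]_n,
  forall i, - rho <= x ord0 i <= rho &
  forall (j : 'I_n) (U : set 'rV[R]_n), nbhs x U -> exists p r s,
    [/\ U (node p r), U (node p s), lab p j r = false & lab p j s = true].
Proof.
have [q hq] : {q : nat -> {ffun 'I_n -> nat} & forall p,
  (forall j, (q p j < p.+1)%N) /\
    forall j, exists r s, [/\ lab p j r = false, lab p j s = true &
     forall i, (q p i <= r i <= (q p i).+1)%N &&
               (q p i <= s i <= (q p i).+1)%N]}.
  apply: (@choice _ _ (fun p (q : {ffun 'I_n -> nat}) =>
    (forall j, (q j < p.+1)%N) /\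
    forall j, exists r s, [/\ lab p j r = false, lab p j s = true &
     forall i, (q i <= r i <= (q i).+1)%N && (q i <= s i <= (q i).+1)%N])).
  move=> p; apply: kuhn => // j x xj; rewrite /lab xj //.
  by rewrite eqxx.
pose K := [set v : 'rV[R]_n | forall i, v ord0 i \in `[- rho, rho]].
have Kc : compact K.
  apply: (@rV_compact _ _ (fun=> `[- rho, rho]%classic)) => _.
  exact: segment_compact.
pose u p := node p (q p).
have uK : \forall p \near \oo, K (u p).
  apply: nearW => p i /=; rewrite in_itv /= mxE.
  have /ltnW := (hq p).1 i; rewrite -(ler_nat R) => h.
  have h1 : 0 <= 2 * rho * (q p i)%:R / p.+1%:R.
    by rewrite !mulr_ge0 // ?invr_ge0 // ltW.
  have h2 : 2 * rho * (q p i)%:R / p.+1%:R <= 2 * rho.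
    by rewrite ler_pdivrMr ?ltr0n // ler_wpM2l // mulr_ge0 // ltW.
  by set t := _ / _ in h1 h2 *; apply/andP; split; lra.
have [x [Kx cx]] := Kc (u @ \oo) _ uK.
exists x => [i|j U /nbhs_ballP [e /= e0 eU]].
  by have := Kx i; rewrite /= in_itv.
have e2 : 0 < e / 2 by rewrite divr_gt0.
(* This set remembers the index, so that a corner close to [x] can be found together with a small
   mesh size. *)
have Nbig : \forall p \near \oo,
    [set y | exists2 p, y = u p & 2 * rho / p.+1%:R < e / 2] (u p).
  near=> p; exists p => //.
  rewrite ltr_pdivrMr ?ltr0n // [ltRHS]mulrC -ltr_pdivrMr //.
  apply: (@lt_trans _ _ p%:R); last by rewrite ltr_nat.
  by near: p; exact: nbhs_infty_gtr.
have [y [[p -> pe] xp]] := cx _ _ Nbig (nbhsx_ballx x (e / 2) e2).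
(* A vertex of the cube is within [e / 2] of its corner, which is within [e / 2] of [x]. *)
have near_node (r : {ffun 'I_n -> nat}) :
    (forall i, q p i <= r i <= (q p i).+1)%N -> U (node p r).
  move=> qr; apply: eU; split=> // i' i; rewrite ord1.
  case: xp => _ /(_ ord0 i); rewrite -!ball_normE /= !mxE.
  have /andP[] := qr i; rewrite -!(ler_nat R) -natr1 => h1 h2.
  set a := _ / _; set b := 2 * _ * _ / _ => xa.
  have ab : `|a - b| <= 2 * rho / p.+1%:R.
    rewrite /a /b -!mulrBl -mulrBr -!mulrA !normrM.
    rewrite [`|2|]ger0_norm // [`|rho|](gtr0_norm rho_gt0).
    rewrite [`|_^-1|]ger0_norm ?invr_ge0 // !ler_wpM2l ?(ltW rho_gt0) //.
    rewrite -[leRHS]mul1r ler_wpM2r ?invr_ge0 //.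
    by rewrite ler_norml; lra.
  have -> : x ord0 i - (- rho + b) = x ord0 i - (- rho + a) + (a - b) by ring.
  apply: (le_lt_trans (ler_normD _ _)); rewrite [ltRHS]splitr ltrD //.
  exact: le_lt_trans ab pe.
have [r [s [lr ls qrs]]] := (hq p).2 j.
exists p, r, s; split=> //; apply: near_node => i.
  by case/andP: (qrs i).
by case/andP: (qrs i).
Unshelve. all: by end_near.
Qed.

(** If F_j(x) > 0 and x_j > -rho, both persist near [x], where only a node on the face at -rho can
    carry a false label; the other sign is alike. *)
Lemma variational_inequality : (forall j, continuous (F j)) ->
  exists2 x : 'rV[R]_n, forall i, - rho <= x ord0 i <= rho &
  forall j, (0 < F j x -> x ord0 j = - rho) /\ (F j x < 0 -> x ord0 j = rho).
Proof.
move=> Fc; have [x xK hx] := sign_change_point; exists x => // j.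
split=> Fx; apply/eqP; apply: contraT => xj.
  have : nbhs x [set y | 0 < F j y /\ - rho < y ord0 j].
    apply: filterI.
      exact: (Fc j x _ (lt_nbhsr Fx)).
    have h : - rho < x ord0 j by rewrite lt_def xj; case/andP: (xK j).
    exact: (@coord_continuous R 1 n ord0 j x _ (lt_nbhsr h)).
  move=> /(hx j) [p [r [_ [[Fr rj] _ lr _]]]].
  move: lr rj; rewrite /lab Fr orbT andbT mxE => /negbFE/eqP ->.
  by rewrite mulr0 mul0r addr0 ltxx.
have : nbhs x [set y | F j y < 0 /\ y ord0 j < rho].
  apply: filterI.
    exact: (Fc j x _ (lt_nbhsl Fx)).
  have h : x ord0 j < rho by rewrite lt_neqAle xj; case/andP: (xK j).
  exact: (@coord_continuous R 1 n ord0 j x _ (lt_nbhsl h)).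
move=> /(hx j) [p [_ [s [_ [Fs sj] _ ls]]]].
move: ls sj; rewrite /lab (lt_gtF Fs) orbF mxE => /andP[_ /eqP ->].
by rewrite mulfK ?pnatr_eq0 // => h; exfalso; move: h; lra.
Qed.

(** At the point of [variational_inequality] each x_j F_j(x) is at most 0, while a nonzero F_j(x)
    puts [x] on the boundary, where the sum is positive. *)
Lemma zero_of_outward : (forall j, continuous (F j)) ->
  (forall x : 'rV[R]_n, (exists j, `|x ord0 j| = rho) ->
    0 < \sum_j x ord0 j * F j x) ->
  exists x, forall j, F j x = 0.
Proof.
move=> Fc Fout; have [x xK hx] := variational_inequality Fc; exists x => j.
apply/eqP; apply: contraT => Fj; exfalso.
have xF i : x ord0 i * F i x <= 0.
  have [Fi|Fi|->] := ltgtP (F i x) 0; last by rewrite mulr0.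
  - by rewrite ((hx i).2 Fi) pmulr_rle0 // ltW.
  - by rewrite ((hx i).1 Fi) nmulr_rle0 ?oppr_lt0 // ltW.
have : 0 < \sum_j x ord0 j * F j x.
  apply: Fout; exists j; move: Fj; rewrite neq_lt => /orP[/(hx j).2|/(hx j).1] ->.
    by rewrite gtr0_norm.
  by rewrite normrN gtr0_norm.
by rewrite ltNge sumr_le0.
Qed.
End VariationalInequality.

(** * Norms on finite-dimensional spaces *)

Section FiniteDimension.
Variables (R : realType) (V : vectType R).
Let n := \dim {:V}.
Let b := vbasis {:V}.

Definition lincomb (x : 'rV[R]_n) : V := \sum_(i < n) x ord0 i *: b`_i.

Lemma coord_lincomb x i : coord b i (lincomb x) = x ord0 i.
Proof. by rewrite coord_sum_free // (basis_free (vbasisP _)). Qed.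

Lemma lincomb_coord u : lincomb (\row_i coord b i u) = u.
Proof.
rewrite [RHS](coord_vbasis (memvf u)); apply: eq_bigr => i _; by rewrite mxE.
Qed.

Lemma lincombB x y : lincomb (x - y) = lincomb x - lincomb y.
Proof. by rewrite -sumrB; apply: eq_bigr => i _; rewrite !mxE scalerBl. Qed.

Lemma lincombZ a x : lincomb (a *: x) = a *: lincomb x.
Proof. by rewrite scaler_sumr; apply: eq_bigr => i _; rewrite mxE scalerA. Qed.

Lemma coord_le_norm (x : 'rV[R]_n) i : `|x ord0 i| <= `|x|.
Proof.
rewrite (_ : `|x| = mx_norm x) // mx_normrE.
exact: (le_bigmax _ (fun ij => `|x ij.1 ij.2|) (ord0, i)).
Qed.

Variable N : V -> R.
Hypothesis ND : forall u v, N (u + v) <= N u + N v.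
Hypothesis NZ : forall a u, N (a *: u) = `|a| * N u.
Hypothesis N0 : forall u, N u = 0 -> u = 0.

Lemma seminorm_ge0 u : 0 <= N u.
Proof.
have := ND u (- 1 *: u); rewrite NZ normrN1 mul1r scaleN1r subrr.
have -> : N 0 = 0 by rewrite -(scale0r (0 : V)) NZ normr0 mul0r.
by lra.
Qed.

Lemma seminorm_lincomb x : N (lincomb x) <= `|x| * \sum_(i < n) N b`_i.
Proof.
rewrite mulr_sumr /lincomb.
apply: (@le_trans _ _ (\sum_(i < n) N (x ord0 i *: b`_i))).
  elim/big_ind2: _ => // [|a1 a2 c1 c2 h1 h2].
    by rewrite -(scale0r (0 : V)) NZ normr0 mul0r.
  by apply: le_trans (ND _ _) _; apply: lerD.
by apply: ler_sum => i _; rewrite NZ ler_wpM2r ?seminorm_ge0 ?coord_le_norm.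
Qed.

(** The reverse triangle inequality makes [N] Lipschitz in the coordinates. *)
Lemma continuous_seminorm_lincomb : continuous (N \o lincomb).
Proof.
move=> x s /= /nbhs_ballP[e /= e0 es]; pose K := \sum_(i < n) N b`_i.
have K0 : 0 <= K by apply: sumr_ge0 => i _; exact: seminorm_ge0.
have dN y : `|N (lincomb x) - N (lincomb y)| <= `|x - y| * K.
  apply: le_trans (seminorm_lincomb (x - y)); rewrite lincombB.
  have h1 := ND (lincomb x - lincomb y) (lincomb y); rewrite subrK in h1.
  have h2 := ND (lincomb y - lincomb x) (lincomb x); rewrite subrK in h2.
  have h3 := NZ (-1) (lincomb x - lincomb y).
  rewrite scaleN1r opprB normrN1 mul1r in h3.
  by rewrite ler_norml; apply/andP; split; lra.
have eK : 0 < e / (K + 1) by rewrite divr_gt0 // ltr_wpDl.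
apply/nbhs_ballP; exists (e / (K + 1)) => // y; rewrite -ball_normE /= => xy.
apply: es; rewrite -ball_normE /=.
apply: le_lt_trans (dN y) _.
apply: (@le_lt_trans _ _ (`|x - y| * (K + 1))).
  by rewrite ler_wpM2l // lerDl.
by rewrite -ltr_pdivlMr ?ltr_wpDl.
Qed.

(** Equivalence of norms: [N] attains a positive minimum on the compact unit sphere of coordinates,
    and [C] is its inverse. *)
Lemma coord_le_seminorm : exists2 C, 0 <= C &
  forall u i, `|coord b i u| <= C * N u.
Proof.
pose S := [set x : 'rV[R]_n | `|x| = 1].
have [S0|S0] := pselect (S !=set0); last first.
  (* An empty unit sphere forces all coordinates to vanish. *)
  exists 0 => // u i; rewrite mul0r normr_le0; apply: contraT => ui.
  exfalso; apply: S0; pose x := \row_i coord b i u.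
  have x0 : x != 0.
    by apply: contraNneq ui => /rowP /(_ i); rewrite !mxE => ->.
  by exists (`|x|^-1 *: x); rewrite /S /= normrZ normfV normr_id mulVf //
    normr_eq0.
have Sc : compact S.
  apply: bounded_closed_compact.
    by exists 1; split=> // r r1 x /= ->; exact: ltW.
  apply: (@closed_comp _ _ (fun x : 'rV[R]_n => `|x|) [set 1]).
    by move=> x _; exact: norm_continuous.
  exact: closed_eq.
have [c] := EVT_min_rV S0 Sc (continuous_subspaceT continuous_seminorm_lincomb).
rewrite inE => Sc1 cmin.
have c0 : 0 < N (lincomb c).
  rewrite lt_neqAle seminorm_ge0 andbT eq_sym; apply/eqP => /N0 c0.
  have : c = 0 by apply/rowP => i; rewrite -coord_lincomb c0 mxE linear0.
  by move=> c00; move: Sc1;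
  rewrite /S /= c00 normr0 => /esym/eqP; rewrite oner_eq0.
exists (N (lincomb c))^-1; first by rewrite invr_ge0 ltW.
move=> u i; rewrite -{2}(lincomb_coord u); set x := \row_i _.
have -> : coord b i u = x ord0 i by rewrite mxE.
apply: le_trans (coord_le_norm x i) _; rewrite mulrC ler_pdivlMr //.
have [->|x0] := eqVneq x 0.
  by rewrite normr0 mul0r seminorm_ge0.
have := cmin (`|x|^-1 *: x); rewrite inE.
have nx : 0 < `|x| by rewrite normr_gt0.
rewrite /S /= normrZ normfV normr_id mulVf ?gt_eqF // => /(_ erefl).
by rewrite lincombZ NZ normfV normr_id ler_pdivlMl.
Qed.

Lemma linear_bounded (W : normedModType R) (f : {linear V -> W}) :
  exists2 C, 0 <= C & forall u, `|f u| <= C * N u.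
Proof.
have [C C0 hC] := coord_le_seminorm.
exists (\sum_(i < n) C * `|f b`_i|).
  by apply: sumr_ge0 => i _; rewrite mulr_ge0.
move=> u; rewrite {1}(coord_vbasis (memvf u)) linear_sum mulr_suml.
apply: le_trans (ler_norm_sum _ _ _) _; apply: ler_sum => i _.
rewrite linearZ normrZ mulrAC ler_wpM2r //; exact: hC.
Qed.

End FiniteDimension.

(** * Existence for an abstract Galerkin problem *)

Lemma functional_lincomb (R : realType) (V : vectType R) (g : V -> R) :
    linear_functional g ->
  forall x, g (lincomb x) = \sum_i x ord0 i * g (vbasis {:V})`_i.
Proof.
move=> gl x; have g0 : g 0 = 0.
  by have := gl 1 0 0; rewrite scaler0 addr0 mul1r; lra.
rewrite /lincomb; elim/big_rec2: _ => // i y z _ <-; exact: gl.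
Qed.

Section ContinuousFunctions.
Variables (R : realType) (T : topologicalType).

Lemma continuous_add (f g : T -> R) : continuous f -> continuous g ->
  continuous (fun x => f x + g x).
Proof. by move=> fc gc x; apply: cvgD; [exact: fc | exact: gc]. Qed.

Lemma continuous_mul (f g : T -> R) : continuous f -> continuous g ->
  continuous (fun x => f x * g x).
Proof. by move=> fc gc x; apply: cvgM; [exact: fc | exact: gc]. Qed.

Lemma continuous_sum (I : Type) (r : seq I) (f : I -> T -> R) :
    (forall i, continuous (f i)) -> continuous (fun x => \sum_(i <- r) f i x).
Proof.
move=> fc; elim: r => [|i r IH].
  rewrite (_ : (fun _ => _) = fun=> 0 : R); first exact: cst_continuous.
  by apply/funext => y; rewrite big_nil.
rewrite (_ : (fun _ => _) = fun y => f i y + \sum_(i <- r) f i y).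
  exact: continuous_add.
by apply/funext => y; rewrite big_cons.
Qed.

End ContinuousFunctions.

(** F_j is the residual [G] tested with the j-th basis vector, so the sum of x_j F_j(x) is the
    residual at u tested with u itself. It is at least c N(u)^2 - K N(u), which is positive once
    N(u) > K / c. *)
Lemma galerkin_solution (R : realType) (V : vectType R) (N : V -> R)
    (a : V -> V -> R) (b : V -> V -> V -> R) (l : V -> R) (c : R) :
    (forall u v, N (u + v) <= N u + N v) ->
    (forall a u, N (a *: u) = `|a| * N u) ->
    (forall u, N u = 0 -> u = 0) ->
    bilinear_form a -> trilinear_form b -> linear_functional l ->
    0 < c -> (forall u, c * N u ^+ 2 <= a u u) -> (forall u v, b u v v = 0) ->
  exists u, forall v, a u v + b u u v = l v.
Proof.
move=> ND NZ N0 [al ar] [b1 [b2 b3]] ll c0 coer bskew.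
pose n := \dim {:V}; pose e i := (vbasis {:V})`_i.
pose G u v := a u v + b u u v - l v.
have Gl u : linear_functional (G u).
  by move=> s x y; rewrite /G ar b3 ll; ring.
pose F (j : 'I_n) x := G (lincomb x) (e j).
have Fc j : continuous (F j).
  (* In coordinates F_j is a polynomial of degree at most 2, hence continuous. *)
  have -> : F j = fun x => \sum_(i < n) x ord0 i * a (e i) (e j)
     + \sum_(i < n) \sum_(m < n) x ord0 i * (x ord0 m * b (e i) (e m) (e j))
     - l (e j).
    apply/funext => x; rewrite /F /G; congr (_ + _ - _).
      by apply: (@functional_lincomb _ _ (a^~ (e j))) => s y z; exact: al.
    rewrite (@functional_lincomb _ _ (fun u => b u (lincomb x) (e j))).
      apply: eq_bigr => i _; rewrite -mulr_sumr; congr (_ * _).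
      apply: (@functional_lincomb _ _ (fun u => b _ u (e j))) => s y z.
      exact: b2.
    by move=> s y z; exact: b1.
  have cc i : continuous (fun x : 'rV[R]_n => x ord0 i) by exact: coord_continuous.
  apply: continuous_add; last exact: cst_continuous.
  apply: continuous_add.
    apply: continuous_sum => i.
    by apply: continuous_mul; [exact: cc | exact: cst_continuous].
  apply: continuous_sum => i; apply: continuous_sum => m.
  apply: continuous_mul; first exact: cc.
  by apply: continuous_mul; [exact: cc | exact: cst_continuous].
have [C C0 hC] := coord_le_seminorm ND NZ N0.
pose K := \sum_(i < n) C * `|l (e i)|.
have K0 : 0 <= K by apply: sumr_ge0 => i _; rewrite mulr_ge0.
(* On the boundary rho = |x_j| <= C N(u), which gives N(u) >= K / c + 1; [C + 1] stays positive when
   C = 0. *)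
pose rho := (C + 1) * (K / c + 1).
have Kc : 0 <= K / c by rewrite divr_ge0 // ltW.
have rho0 : 0 < rho by rewrite mulr_gt0 // ltr_wpDl.
have lK u : l u <= K * N u.
  rewrite -{1}(lincomb_coord u) functional_lincomb // mulr_suml.
  apply: ler_sum => i _; rewrite mxE mulrAC.
  apply: le_trans (ler_norm _) _; rewrite normrM ler_wpM2r //; exact: hC.
have [|x Fx] := zero_of_outward rho0 Fc.
  move=> x [j xj]; rewrite -functional_lincomb //; set u := lincomb x.
  have Nu := seminorm_ge0 ND NZ u.
  have rN : rho <= C * N u by rewrite -xj -coord_lincomb; exact: hC.
  have KN : K / c < N u.
    have : (C + 1) * (K / c + 1) <= (C + 1) * N u.
      by apply: (le_trans rN); rewrite ler_wpM2r // lerDl.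
    by rewrite ler_pM2l ?ltr_wpDl //; lra.
  have N1 : 0 < N u by exact: le_lt_trans Kc KN.
  rewrite /G bskew addr0 subr_gt0; apply: (le_lt_trans (lK u)).
  apply: lt_le_trans (coer u).
  by rewrite expr2 mulrA ltr_pM2r // mulrC -ltr_pdivrMr.
exists (lincomb x) => v; apply/eqP; rewrite -subr_eq0 -/(G _ v).
rewrite -(lincomb_coord v) functional_lincomb // big1 // => i _.
by rewrite [G _ _]Fx mulr0.
Qed.

(** * Euclidean product norms on tuples *)

Section ProductNorm.
Variables (R : realType) (k : nat).

Lemma tnorm_ge0 (V : normedModType R) (f : {ffun 'I_k -> V}) : 0 <= tnorm f.
Proof. exact: sqrtr_ge0. Qed.

Lemma norm_le_tnorm (V : normedModType R) (f : {ffun 'I_k -> V}) i :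
  `|f i| <= tnorm f.
Proof.
rewrite -[leLHS]ger0_norm // -sqrtr_sqr ler_wsqrtr // (bigD1 i) //= lerDl.
by apply: sumr_ge0 => j _; exact: sqr_ge0.
Qed.

Lemma tnorm_eq0 (V : normedModType R) (f : {ffun 'I_k -> V}) :
  tnorm f = 0 -> f = 0.
Proof.
move=> f0; apply/ffunP => i; rewrite ffunE; apply/eqP.
by rewrite -normr_le0 -f0 norm_le_tnorm.
Qed.

Lemma tnorm_gt0 (V : normedModType R) (f : {ffun 'I_k -> V}) :
  f != 0 -> 0 < tnorm f.
Proof.
move=> f0; rewrite lt_neqAle tnorm_ge0 andbT eq_sym.
by apply: contra f0 => /eqP/tnorm_eq0 ->.
Qed.

Lemma tnorm0 (V : normedModType R) : tnorm (0 : {ffun 'I_k -> V}) = 0.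
Proof.
by rewrite /tnorm big1 ?sqrtr0 // => i _; rewrite ffunE normr0 expr0n.
Qed.

Lemma tnorm_tmap_le (X : Type) (U V : normedModType R) (f : X -> U) (g : X -> V)
    (c : R) : 0 <= c -> (forall x, `|f x| <= c * `|g x|) ->
  forall p : {ffun 'I_k -> X}, tnorm (tmap f p) <= c * tnorm (tmap g p).
Proof.
move=> c0 fg p; rewrite -[X in X * _](ger0_norm c0) -sqrtr_sqr.
rewrite -sqrtrM ?sqr_ge0 //
  ler_wsqrtr // mulr_sumr; apply: ler_sum => i _; rewrite !ffunE.
by rewrite -exprMn lerXn2r ?nnegrE // mulr_ge0.
Qed.

Lemma tmap_linear (U V : lmodType R) (f : {linear U -> V}) a
    (p q : {ffun 'I_k -> U}) :
  tmap f (a *: p + q) = a *: tmap f p + tmap f q.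
Proof. by apply/ffunP => i; rewrite !ffunE linearP. Qed.

End ProductNorm.

(** * Constants defined as suprema of quotients *)

Section Suprema.
Variable R : realType.

(** Where no supremum exists, [sup] takes the default value 0, which also satisfies the bound. *)
Lemma sup_nonneg (S : set R) : (forall x, S x -> 0 <= x) -> 0 <= sup S.
Proof.
move=> S0; have [hs|/sup_out ->//] := pselect (has_sup S).
have [x Sx] := hs.1; exact: le_trans (S0 _ Sx) (ub_le_sup hs.2 Sx).
Qed.

Lemma dualnorm_ge0 k (V : normedModType R) (L : {ffun 'I_k -> V} -> R) :
  0 <= dualnorm (@tnorm R k V) L.
Proof. by apply: sup_nonneg => r [x [_ ->]]; rewrite divr_ge0 // tnorm_ge0. Qed.

(** Continuity bounds the quotients, so [sup] is an upper bound of them and not the default 0. *)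
Lemma le_dualnorm k (V : normedModType R) (L : {ffun 'I_k -> V} -> R) :
    (exists c, forall x, `|L x| <= c * tnorm x) ->
  forall x, `|L x| <= dualnorm (@tnorm R k V) L * tnorm x.
Proof.
move=> [c Lc] x; have [->|x0] := eqVneq x 0.
  by apply: le_trans (Lc 0) _; rewrite tnorm0 !mulr0.
rewrite -ler_pdivrMr ?tnorm_gt0 //; apply: ub_le_sup; last by exists x.
by exists c => _ [y [y0 ->]]; rewrite ler_pdivrMr ?tnorm_gt0.
Qed.

Lemma trinorm_ge0 k (V1 V2 V3 : normedModType R)
    (B : {ffun 'I_k -> V1} -> {ffun 'I_k -> V2} -> {ffun 'I_k -> V3} -> R) :
  0 <= trinorm (@tnorm R k V1) (@tnorm R k V2) (@tnorm R k V3) B.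
Proof.
apply: sup_nonneg => r [x [y [z [_ [_ [_ ->]]]]]].
by rewrite divr_ge0 // !mulr_ge0 // tnorm_ge0.
Qed.

Lemma le_trinorm k (V1 V2 V3 : normedModType R)
    (B : {ffun 'I_k -> V1} -> {ffun 'I_k -> V2} -> {ffun 'I_k -> V3} -> R) :
    (exists c, forall x y z, `|B x y z| <= c * tnorm x * tnorm y * tnorm z) ->
  forall x y z, `|B x y z| <=
    trinorm (@tnorm R k V1) (@tnorm R k V2) (@tnorm R k V3) B
      * (tnorm x * tnorm y * tnorm z).
Proof.
move=> [c Bc] x y z.
have [->|x0] := eqVneq x 0.
  by apply: le_trans (Bc _ _ _) _; rewrite tnorm0 !(mulr0, mul0r).
have [->|y0] := eqVneq y 0.
  by apply: le_trans (Bc _ _ _) _; rewrite tnorm0 !(mulr0, mul0r).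
have [->|z0] := eqVneq z 0.
  by apply: le_trans (Bc _ _ _) _; rewrite tnorm0 !(mulr0, mul0r).
rewrite -ler_pdivrMr ?mulr_gt0 ?tnorm_gt0 //; apply: ub_le_sup.
  exists c => _ [x' [y' [z' [x'0 [y'0 [z'0 ->]]]]]].
  by rewrite ler_pdivrMr ?mulr_gt0 ?tnorm_gt0 // !mulrA.
by exists x, y, z.
Qed.

Variables (XD : vectType R) (L2 L4 M H : normedModType R).
Variables (PiD : {linear XD -> L2}) (GD : {linear XD -> L4}).
Variables (HD : {linear XD -> M}) (Hess : {linear H -> M}).
Variable ED : {linear XD -> H}.
Hypothesis HDnorm : forall w : XD, `|HD w| = 0 -> w = 0.

Let HD_gt0 w : w != 0 -> 0 < `|HD w|.
Proof.
move=> w0; rewrite lt_neqAle normr_ge0 andbT eq_sym.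
by apply: contra w0 => /eqP/HDnorm ->.
Qed.

Lemma Gamma_ge0 : 0 <= Gamma HD Hess ED.
Proof. by apply: sup_nonneg => r [x [_ ->]]; rewrite divr_ge0. Qed.

Lemma le_Gamma : has_ubound (Gamma_set HD Hess ED) ->
  forall w, `|Hess (ED w)| <= Gamma HD Hess ED * `|HD w|.
Proof.
move=> hG w; have [->|w0] := eqVneq w 0; first by rewrite !linear0 normr0 mulr0.
by rewrite -ler_pdivrMr ?HD_gt0 //; apply: ub_le_sup => //; exists w.
Qed.

Lemma C_D_ge0 : 0 <= C_D PiD GD HD.
Proof.
by apply: sup_nonneg => r [x [_ ->]]; rewrite le_max divr_ge0.
Qed.

(** Linear maps on the finite-dimensional [XD] are bounded for the norm |HD w|, so the set defining
    [C_D] is bounded above. *)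
Lemma le_C_D w : `|GD w| <= C_D PiD GD HD * `|HD w|.
Proof.
have [->|w0] := eqVneq w 0; first by rewrite !linear0 !normr0 mulr0.
have ND u v : `|HD (u + v)| <= `|HD u| + `|HD v| by rewrite linearD ler_normD.
have NZ a u : `|HD (a *: u)| = `|a| * `|HD u| by rewrite linearZ normrZ.
have [c1 c10 h1] := linear_bounded ND NZ HDnorm PiD.
have [c2 c20 h2] := linear_bounded ND NZ HDnorm GD.
rewrite -ler_pdivrMr ?HD_gt0 //.
apply: (@le_trans _ _ (Num.max (`|PiD w| / `|HD w|) (`|GD w| / `|HD w|))).
  by rewrite le_max lexx orbT.
apply: ub_le_sup; last by exists w.
exists (Num.max c1 c2) => _ [v [v0 ->]].
rewrite ge_max !le_max !ler_pdivrMr ?HD_gt0 //.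
by rewrite h1 h2 orbT.
Qed.

End Suprema.

(** * The Hessian scheme *)

Theorem theorem3p3
  (R : realType) (k : nat)
  (* scalar function spaces: L^2(Omega), L^4(Omega;R^d), L^2(Omega;R^{dxd}), H^2_0(Omega) *)
  (L2 L4 M H : normedModType R)
  (* Hessian on H^2_0 and the constant C_{2,eq} *)
  (Hess : {linear H -> M}) (C2eq : R)
  (hC2eq : forall phi : H, `|phi| <= C2eq * `|Hess phi|)
  (* the form A: continuous, coercive bilinear form on L^2(Omega;R^{dxd})^k *)
  (A : {ffun 'I_k -> M} -> {ffun 'I_k -> M} -> R) (alpha : R)
  (hA : bilinear_form A)
  (hAc : exists c : R, forall x y, `|A x y| <= c * tnorm x * tnorm y)
  (halpha : 0 < alpha)
  (hAcoer : forall X, alpha * tnorm X ^+ 2 <= A X X)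
  (* the form B: continuous trilinear on L^2(..)^k x L^4(..)^k x L^4(..)^k *)
  (B : {ffun 'I_k -> M} -> {ffun 'I_k -> L4} -> {ffun 'I_k -> L4} -> R)
  (hB : trilinear_form B)
  (hBc : exists c : R, forall x y z,
          `|B x y z| <= c * tnorm x * tnorm y * tnorm z)
  (hBskew : forall X T, B X T T = 0)
  (* L in H^{-2}(Omega)^k *)
  (L : {ffun 'I_k -> H} -> R)
  (hL : linear_functional L)
  (hLc : exists c : R, forall x, `|L x| <= c * tnorm x)
  (* Hessian discretisation D = (XD, PiD, GD, HD) *)
  (XD : vectType R)
  (PiD : {linear XD -> L2}) (GD : {linear XD -> L4}) (HD : {linear XD -> M})
  (hHDnorm : forall w : XD, `|HD w| = 0 -> w = 0)
  (* companion operator with Gamma(E_D) < infinity *)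
  (ED : {linear XD -> H})
  (hGamma : has_ubound (Gamma_set HD Hess ED)) :
  let scheme (Psi : {ffun 'I_k -> XD}) : Prop :=
    forall Phi : {ffun 'I_k -> XD},
      A (tmap HD Psi) (tmap HD Phi)
      + B (tmap HD Psi) (tmap GD Psi) (tmap GD Phi)
      = L (tmap ED Phi) in
  (exists Psi, scheme Psi) /\
  (dualnorm (@tnorm R k H) L * trinorm (@tnorm R k M) (@tnorm R k L4) (@tnorm R k L4) B
     * C_D PiD GD HD ^+ 2 * Gamma HD Hess ED * C2eq < alpha ^+ 2 ->
   forall Psi1 Psi2, scheme Psi1 -> scheme Psi2 -> Psi1 = Psi2).
Proof.
move=> scheme.
have HD_D u v : `|HD (u + v)| <= `|HD u| + `|HD v| by rewrite linearD ler_normD.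
have HD_Z a u : `|HD (a *: u)| = `|a| * `|HD u| by rewrite linearZ normrZ.
have [A_l A_r] := hA; have [B1 [B2 B3]] := hB.
have coer Psi : alpha * tnorm (tmap HD Psi) ^+ 2 <=
    A (tmap HD Psi) (tmap HD Psi) by exact: hAcoer.
split.
  (* The sum of the component norms inherits the norm axioms term by term, and is at most k times
     [tnorm]. *)
  pose N (u : {ffun 'I_k -> XD}) := \sum_(i < k) `|HD (u i)|.
  have Nk u : N u <= k%:R * tnorm (tmap HD u).
    rewrite mulr_natl -[k in _ *+ k]card_ord -sumr_const.
    apply: ler_sum => i _; apply: le_trans (norm_le_tnorm (tmap HD u) i).
    by rewrite ffunE.
  (* Coercivity transfers by N^2 <= k^2 tnorm^2; the added 1 keeps the denominator positive for k =
     0. *)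
  have c0 : 0 < alpha / (k%:R ^+ 2 + 1) by rewrite divr_gt0 ?ltr_wpDl ?sqr_ge0.
  apply: (@galerkin_solution R {ffun 'I_k -> XD} N
    (fun u v => A (tmap HD u) (tmap HD v))
    (fun u v w => B (tmap HD u) (tmap GD v) (tmap GD w))
    (fun v => L (tmap ED v)) _ _ _ _ _ _ _ c0) => //.
  - move=> u v; rewrite -big_split; apply: ler_sum => i _.
    by rewrite ffunE HD_D.
  - by move=> a u; rewrite mulr_sumr; apply: eq_bigr => i _; rewrite ffunE HD_Z.
  - move=> u /eqP; rewrite psumr_eq0 // => /allP Nu; apply/ffunP => i.
    by rewrite ffunE; apply: hHDnorm; apply/eqP/(implyP (Nu i _)).
  - by split=> *; rewrite tmap_linear ?A_l ?A_r.
  - by split=> [|]; [|split] => *; rewrite tmap_linear ?B1 ?B2 ?B3.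
  - by move=> *; rewrite tmap_linear hL.
  - move=> u; apply: le_trans (coer u).
    rewrite mulrAC ler_pdivrMr ?ltr_wpDl ?sqr_ge0 // -mulrA ler_pM2l //.
    have N_ge0 : 0 <= N u by apply: sumr_ge0.
    apply: (@le_trans _ _ ((k%:R * tnorm (tmap HD u)) ^+ 2)).
      by rewrite lerXn2r ?nnegrE ?mulr_ge0 ?tnorm_ge0.
    by rewrite exprMn mulrC ler_wpM2l ?sqr_ge0 // lerDl.
move=> small Psi1 Psi2 S1 S2.
set dL := dualnorm _ _ in small; set nB := trinorm _ _ _ _ in small.
set CD := C_D _ _ _ in small; set Gam := Gamma _ _ _ in small.
have dL0 : 0 <= dL by exact: dualnorm_ge0.
have nB0 : 0 <= nB by exact: trinorm_ge0.
have CD0 : 0 <= CD by exact: C_D_ge0.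
have Gam0 : 0 <= Gam by exact: Gamma_ge0.
(* [C2eq < 0] is possible when [H] is trivial. *)
pose C := Num.max 0 C2eq; have C0 : 0 <= C by rewrite le_max lexx.
pose t := tnorm (tmap HD Psi1).
have t0 : 0 <= t by exact: tnorm_ge0.
(* Testing with [Psi1] itself removes B; the case t = 0 is separate because the estimate is then
   divided by t. *)
have apriori : alpha * t <= dL * (C * Gam).
  have ED_le : tnorm (tmap ED Psi1) <= C * Gam * t.
    apply: tnorm_tmap_le => [|w]; first by rewrite mulr_ge0.
    apply: le_trans (hC2eq _) _; rewrite -mulrA.
    apply: (@le_trans _ _ (C * `|Hess (ED w)|)).
      by rewrite ler_wpM2r // le_max lexx orbT.
    by rewrite ler_wpM2l // le_Gamma.
  have [->|tn0] := eqVneq t 0; first by rewrite mulr0 !mulr_ge0.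
  have tp : 0 < t by rewrite lt_neqAle eq_sym tn0.
  rewrite -(ler_pM2r tp) -[leLHS]mulrA -expr2.
  apply: le_trans (coer Psi1) _.
  have := S1 Psi1; rewrite hBskew addr0 => ->.
  apply: le_trans (ler_norm _) _; apply: le_trans (le_dualnorm hLc _) _.
  by rewrite -mulrA ler_wpM2l.
pose e := Psi1 - Psi2; pose h := tnorm (tmap HD e).
have h0 : 0 <= h by exact: tnorm_ge0.
have e_eq0 : h = 0 -> Psi1 = Psi2.
  move=> /tnorm_eq0 he; apply/eqP; rewrite -subr_eq0 -/e; apply/eqP/ffunP => i.
  rewrite [RHS]ffunE; apply: hHDnorm; have /ffunP/(_ i) := he.
  by rewrite ffunE [RHS]ffunE => ->; rewrite normr0.
have bound : alpha * h ^+ 2 <= nB * (h * (CD * t) * (CD * h)).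
  have A_B : A (tmap HD e) (tmap HD e) =
      - B (tmap HD e) (tmap GD Psi1) (tmap GD e).
    have He : tmap HD e = -1 *: tmap HD Psi2 + tmap HD Psi1.
      by rewrite -tmap_linear scaleN1r addrC.
    have Ge : tmap GD e = -1 *: tmap GD Psi2 + tmap GD Psi1.
      by rewrite -tmap_linear scaleN1r addrC.
    (* This replaces [Psi2] by [Psi1] in the middle slot of B(H Psi2, G Psi2, Ge), so that the two B
       terms combine into one in He. *)
    have skew : B (tmap HD Psi2) (tmap GD e) (tmap GD e) = 0 by exact: hBskew.
    rewrite [X in B _ X]Ge B2 in skew.
    rewrite [X in A X]He A_l [in RHS]He B1.
    by have := S1 e; have := S2 e; lra.
  apply: le_trans (coer e) _; rewrite A_B; apply: le_trans (ler_norm _) _.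
  rewrite normrN; apply: le_trans (le_trinorm hBc _ _ _) _.
  have GD_le p : tnorm (tmap GD p) <= CD * tnorm (tmap HD p).
    by apply: tnorm_tmap_le => // w; exact: le_C_D.
  by rewrite ler_wpM2l // !ler_pM ?mulr_ge0 ?tnorm_ge0 ?GD_le.
(* For negative [C2eq] the constant [C] is 0 and the left side vanishes. *)
have smallC : dL * nB * CD ^+ 2 * Gam * C < alpha ^+ 2.
  rewrite /C; case: (leP 0 C2eq) => // _.
  by rewrite mulr0 exprn_gt0.
(* If h is nonzero, division of [bound] by h^2 gives alpha <= nB CD^2 t; multiplied by alpha and
   combined with [apriori], this contradicts smallness. *)
apply: e_eq0; apply/eqP; apply: contraLR smallC => hn0; rewrite -leNgt.
have hp : 0 < h ^+ 2 by rewrite exprn_gt0 // lt_neqAle eq_sym hn0.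
have alpha_le : alpha <= nB * CD ^+ 2 * t.
  rewrite -(ler_pM2r hp); apply: (le_trans bound).
  by rewrite le_eqVlt; apply/orP; left; apply/eqP; ring.
apply: (@le_trans _ _ (nB * CD ^+ 2 * (alpha * t))).
  by rewrite expr2 [leRHS]mulrCA ler_wpM2l ?(ltW halpha).
apply: le_trans (ler_wpM2l _ apriori) _; first by rewrite mulr_ge0 // sqr_ge0.
by rewrite le_eqVlt; apply/orP; left; apply/eqP; ring.
Qed.
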